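(* Let $\mathcal{X}$ be a Polish space with Borel $\sigma$-field $\mathcal{B}$, let $P$ be a Markov operator on $\mathcal{X}$ with transition kernel $p$, and suppose that $P$ admits a unique invariant probability measure $\pi$ and that $\pi$ is reversible for $P$. Suppose there exist a measurable function $V:\mathcal{X}\to[1,\infty)$, real numbers $b<\infty$, $\alpha>0$, $\lambda>0$, a measurable set $K\subseteq\mathcal{X}$, and a probability measure $\nu$ on $(\mathcal{X},\mathcal{B})$ such that $$PV(x)\le (1-\lambda)V(x)+b\,\mathbf{1}_K(x)\quad\text{for all }x\in\mathcal{X},$$ $$P\mathbf{1}_A(x)\ge \alpha\,\nu(A)\,\mathbf{1}_K(x)\quad\text{for all }x\in\mathcal{X},\ A\in\mathcal{B}.$$ If in addition $P$ is a positive semi-definite operator on $L^2(\pi)$ (i.e. $\langle f,Pf\rangle_\pi\ge 0$ for all $f\in L^2(\pi)$), then $P$ admits the spectral gap $\beta=\frac{\lambda}{1+\frac{2b}{\alpha}}$ in $L^2_0(\pi)$, i.e. $$\|P\|_{L^2_0(\pi)}\le 1-\frac{\lambda}{1+\frac{2b}{\alpha}}.$$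
   Context: A Markov operator $P$ on $\mathcal{X}$ is given by a probability transition kernel $p:\mathcal{X}\times\mathcal{B}\to[0,1]$ via $Pf(x)=\int_{\mathcal{X}} f(y)\,p(x,dy)$ for bounded measurable $f$ (and also for nonnegative measurable $f$). It acts on probability measures by $\mu P(\cdot)=\int_{\mathcal{X}}p(x,\cdot)\,d\mu(x)$. A probability measure $\pi$ is invariant if $\pi P=\pi$; then $P$ is a bounded linear operator on the real space $L^2(\pi)$, which carries the inner product $\langle f,g\rangle_\pi=\int fg\,d\pi$ and norm $\|f\|_{2,\pi}^2=\langle f,f\rangle_\pi$. The invariant measure $\pi$ is reversible if $\langle f,Pg\rangle_\pi=\langle Pf,g\rangle_\pi$ for all $f,g\in L^2(\pi)$. $L^2_0(\pi)=\{f\in L^2(\pi):\int f\,d\pi=0\}$, and $\mathbf{1}_A$ is the indicator function of $A$. The norm is $\|P\|_{L^2_0(\pi)}=\sup_{f\in L^2_0(\pi),\,f\ne0}\|Pf\|_{2,\pi}/\|f\|_{2,\pi}$. $P$ is said to admit a spectral gap $\beta>0$ in $L^2_0(\pi)$ if $\|P\|_{L^2_0(\pi)}\le 1-\beta$. *)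

(* Defs.v *)
From HB Require Import structures.
From mathcomp Require Import all_boot all_order all_algebra.
From mathcomp Require Import all_classical all_reals all_analysis.

Set Implicit Arguments.
Unset Strict Implicit.
Unset Printing Implicit Defensive.

Import Order.TTheory GRing.Theory Num.Theory.
Import numFieldNormedType.Exports.

Local Open Scope classical_set_scope.
Local Open Scope ring_scope.

Definition separable (X : topologicalType) : Prop :=
  exists2 D : set X, countable D & dense D.

Definition is_metric (R : realType) (X : Type) (dist : X -> X -> R) : Prop :=
  [/\ forall x y, 0 <= dist x y,
      forall x y, dist x y = 0 <-> x = y,
      forall x y, dist x y = dist y x &
      forall x y z, dist x z <= dist x y + dist y z].

Definition metrizes (R : realType) (X : topologicalType)
    (dist : X -> X -> R) : Prop :=
  forall (x : X) (A : set X),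
    nbhs x A <-> exists2 e : R, 0 < e & [set y | dist x y < e] `<=` A.

Definition complete_metric (R : realType) (X : topologicalType)
    (dist : X -> X -> R) : Prop :=
  forall u : nat -> X,
    (forall e : R, 0 < e -> exists N : nat, forall m n : nat,
       (N <= m)%N -> (N <= n)%N -> dist (u m) (u n) < e) ->
    exists l : X, u @ \oo --> l.

Definition polish (R : realType) (X : topologicalType) : Prop :=
  separable X /\
  exists dist : X -> X -> R,
    [/\ is_metric dist, metrizes dist & complete_metric dist].

Notation borelType X := (g_sigma_algebraType (@open X)).

Section markov.
Context d (X : measurableType d) (R : realType).
Implicit Types (p : R.-pker X ~> X) (mu pi : probability X R).

Local Open Scope ereal_scope.

(* Functions take values in [\bar R]: [P f x] may be infinite for nonnegative
   [f], and for [f] in L^2(pi) with [pi] invariant the integral is well defined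
   and finite only for pi-almost every [x]. *)
Definition markov_op p (f : X -> \bar R) : X -> \bar R :=
  fun x => \int[p x]_y f y.

Definition markov_act p mu : set X -> \bar R :=
  fun A => \int[mu]_x p x A.

Definition invariant_proba p pi : Prop :=
  forall A : set X, measurable A -> markov_act p pi A = pi A.

Definition unique_invariant_proba p pi : Prop :=
  invariant_proba p pi /\
  forall mu, invariant_proba p mu ->
    forall A : set X, measurable A -> mu A = pi A.

(* Elements of L^2(pi) are represented by real-valued functions
   [f \in Lfun pi 2], identified when equal pi-almost everywhere. *)
Definition inner_L2 pi (f g : X -> \bar R) : \bar R :=
  \int[pi]_x (f x * g x).

Definition reversible p pi : Prop :=
  forall f g : X -> R, f \in Lfun pi 2%:E -> g \in Lfun pi 2%:E ->
    inner_L2 pi (EFin \o f) (markov_op p (EFin \o g)) =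
    inner_L2 pi (markov_op p (EFin \o f)) (EFin \o g).

Definition pos_semidef_L2 p pi : Prop :=
  forall f : X -> R, f \in Lfun pi 2%:E ->
    0 <= inner_L2 pi (EFin \o f) (markov_op p (EFin \o f)).

Definition L2_0 pi : set (X -> R) :=
  [set f | f \in Lfun pi 2%:E /\ \int[pi]_x (f x)%:E = 0].

(* [0] is added to the set of quotients so that the norm is [0], and not [-oo],
   when L^2_0(pi) is trivial. *)
Definition opnorm_L2_0 p pi : \bar R :=
  ereal_sup (0 |`
    [set 'N[pi]_2%:E[markov_op p (EFin \o f)] / 'N[pi]_2%:E[EFin \o f] |
       f in [set f : X -> R | L2_0 pi f /\ ~ (f = cst 0%R %[ae pi])]]).

Definition spectral_gap p pi (beta : R) : Prop :=
  (0 < beta)%R /\ opnorm_L2_0 p pi <= (1 - beta)%:E.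

End markov.

(* Main.v *)
(** With the Dirichlet form E(f) = <f, f> - <f, P f>, half the integral of
    (f x - f y)^2 p(x,dy) pi(dx), AM-GM and reversibility applied to g^2/V and
    V bound <g, P g> by the integral of (g^2/V) PV, so the drift condition gives
      lambda ||g||^2 <= E(g) + b int_K g^2 dpi.
    Take g = f - f(y) with f centred, which leaves E(f) unchanged and does not
    decrease the norm, and integrate over nu(dy): by minorization
    alpha int int_K (f x - f y)^2 dpi dnu <= 2 E(f).  Hence
    lambda ||f||^2 <= (1 + 2b/alpha) E(f), that is <f, P f> <= (1 - beta) ||f||^2
    on L^2_0, and positivity of P turns this into a bound on ||P f||. *)

Require Import Defs.
From HB Require Import structures.
From mathcomp Require Import all_boot all_order all_algebra.
From mathcomp Require Import all_classical all_reals all_analysis.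
From mathcomp Require Import measurable_realfun ring lra.

Set Implicit Arguments.
Unset Strict Implicit.
Unset Printing Implicit Defensive.

Import Order.TTheory GRing.Theory Num.Theory.
Import numFieldNormedType.Exports.

Local Open Scope classical_set_scope.
Local Open Scope ring_scope.

(** * Square-integrable real functions *)

Section L2_functions.
Context d (T : measurableType d) (R : realType) (mu : {measure set T -> \bar R}).
Implicit Types f g : T -> R.

Local Open Scope ereal_scope.

Lemma poweR2_EFin (x : R) : `|x%:E| `^ 2 = (x ^+ 2)%:E.
Proof. by rewrite /= powR_mulrn// real_normK// num_real. Qed.

Lemma Lnorm2_EFin f : 'N[mu]_2%:E[EFin \o f] = (\int[mu]_x (f x ^+ 2)%:E) `^ 2^-1.
Proof. by rewrite unlock; under eq_integral do rewrite poweR2_EFin. Qed.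

Lemma integral_cst_probability (r : R) : mu [set: T] = 1 ->
  \int[mu]_x r%:E = r%:E.
Proof.
by move=> mu1; rewrite (integral_cst mu measurableT r%:E) mu1 mule1.
Qed.

Lemma Lfun2P f : f \in Lfun mu 2%:E <->
  measurable_fun setT f /\ \int[mu]_x (f x ^+ 2)%:E < +oo.
Proof.
split.
  move=> fL; split; first by have := sub_Lfun_mfun fL; rewrite inE.
  have /integrableP[_] := Lfun2_integrable_sqr fL.
  by under eq_integral do rewrite /= ger0_norm ?sqr_ge0//.
move=> [mf fi]; rewrite inE; apply/andP; split; rewrite inE//=.
by rewrite /finite_norm Lnorm2_EFin poweR_lty.
Qed.

(** Linear combinations are kept in this single shape, which serves [f - t P f], [f - c] and affine
    functions of [f] alike. *)
Lemma Lfun2_comb f g (a : R) : f \in Lfun mu 2%:E -> g \in Lfun mu 2%:E ->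
  (fun x => f x + a * g x)%R \in Lfun mu 2%:E.
Proof.
move=> fL gL.
have aL : (a \o* g)%R \in Lfun mu 2%:E by apply: Lfun_scale => //; rewrite ler1n.
have le12 : 1 <= 2%:E :> \bar R by rewrite lee_fin ler1n.
have [_ addL] := Lfun_addr_closed mu le12.
rewrite (_ : (fun x => _) = (f + a \o* g)%R); first exact: addL.
by apply/funext => x; rewrite /= mulrC.
Qed.

Lemma Lfun2_integrable f : mu [set: T] = 1 -> f \in Lfun mu 2%:E ->
  mu.-integrable setT (EFin \o f).
Proof.
move=> mu1 fL; apply/Lfun1_integrable; apply: (Lfun_subset12 _ fL).
by rewrite mu1.
Qed.

Lemma Lfun2_integrableM f g : f \in Lfun mu 2%:E -> g \in Lfun mu 2%:E ->
  mu.-integrable setT (fun x => (f x * g x)%:E).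
Proof.
move=> fL gL; have /Lfun1_integrable := Lfun2_mul_Lfun1 fL gL.
by [].
Qed.

End L2_functions.

(** * Measurability of integrals against the kernel *)

Section kernel.
Context d (X : measurableType d) (R : realType) (p : R.-pker X ~> X).

Local Open Scope ereal_scope.

Lemma measurable_markov_op (h : X -> \bar R) : measurable_fun setT h ->
  measurable_fun setT (markov_op p h).
Proof.
move=> mh.
(* [h] has no sign, so its positive and negative parts are treated separately. *)
rewrite (_ : markov_op p h =
  fun x => \int[p x]_y h^\+ y - \int[p x]_y h^\- y); last first.
  by apply/funext => x; rewrite /markov_op integralE.
apply: emeasurable_funB; apply: measurable_fun_integral_kernel => //.
- by move=> U mU; exact: measurable_kernel.
- exact: measurable_funepos.
- by move=> U mU; exact: measurable_kernel.
- exact: measurable_funeneg.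
Qed.

Lemma measurable_markov2 (h : X * X -> \bar R) : (forall z, 0 <= h z) ->
  measurable_fun setT h ->
  measurable_fun setT (fun x => \int[p x]_y h (x, y)).
Proof. by move=> h0 mh; exact: measurable_fun_integral_finite_kernel. Qed.

End kernel.

(** * Reversibility and invariance for nonnegative functions *)

Section reversible_kernel.
Context d (X : measurableType d) (R : realType) (p : R.-pker X ~> X)
  (pi : probability X R).

Local Open Scope ereal_scope.

Hypothesis rev : reversible p pi.

(** Reversibility is stated on L^2(pi). The truncations at level n are bounded, hence in L^2(pi),
    and increase to [u]. *)
Let trunc (u : X -> R) (n : nat) x := Num.min (u x) n%:R.

Let measurable_trunc (u : X -> R) n : measurable_fun setT u ->
  measurable_fun setT (trunc u n).
Proof. by move=> mu; exact: measurable_minr. Qed.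

Let trunc_ge0 (u : X -> R) n x : (forall x, 0 <= u x)%R -> (0 <= trunc u n x)%R.
Proof. by move=> u0; rewrite /trunc le_min u0 ler0n. Qed.

Let nd_trunc u x (m n : nat) : (m <= n)%N -> (trunc u m x <= trunc u n x)%R.
Proof. by move=> mn; rewrite le_min2 // ler_nat. Qed.

Let trunc_near u x : \forall n \near \oo, trunc u n x = u x.
Proof.
near=> n; apply/min_idPl.
by near: n; exact: nbhs_infty_ger.
Unshelve. all: by end_near. Qed.

Let trunc_Lfun2 (u : X -> R) n : (forall x, 0 <= u x)%R ->
  measurable_fun setT u ->
  trunc u n \in Lfun pi 2%:E.
Proof.
move=> u0 mu; apply/Lfun2P; split; first exact: measurable_trunc.
apply: (@le_lt_trans _ _ (\int[pi]_x (cst ((n%:R ^+ 2)%:E) x))).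
  apply: ge0_le_integral => //.
  - by move=> x _; rewrite lee_fin sqr_ge0.
  - by apply/measurable_EFinP; apply: measurable_funX; exact: measurable_trunc.
  - move=> x _; rewrite lee_fin lerXn2r ?nnegrE ?trunc_ge0//.
    by rewrite ge_min lexx orbT.
by rewrite integral_cst_probability ?ltry//; exact: probability_setT.
Qed.

Let markov_trunc_cvg (v : X -> R) x : (forall x, 0 <= v x)%R ->
  measurable_fun setT v ->
  markov_op p (EFin \o trunc v n) x @[n --> \oo] --> markov_op p (EFin \o v) x.
Proof.
move=> v0 mv; rewrite /markov_op.
rewrite [X in _ --> X](_ : _ =
    \int[p x]_y limn (fun n => (EFin \o trunc v n) y)); last first.
  apply: eq_integral => y _; apply/esym/cvg_lim => //.
  apply: cvg_near_cst.
  by have := trunc_near v y; apply: filterS => n /= ->.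
apply: cvg_monotone_convergence => //.
- by move=> n; apply/measurable_EFinP; exact: measurable_trunc.
- by move=> n y _; rewrite lee_fin trunc_ge0.
- by move=> y _ m n mn; rewrite lee_fin nd_trunc.
Qed.

Let markov_ge0 (h : X -> \bar R) x : (forall y, 0 <= h y) -> 0 <= markov_op p h x.
Proof. by move=> h0; exact: integral_ge0. Qed.

(** Both factors are truncated at the same level, so the integrands increase with n and monotone
    convergence applies. *)
Let inner_trunc_cvg (u v : X -> R) : (forall x, 0 <= u x)%R ->
  measurable_fun setT u ->
  (forall x, 0 <= v x)%R -> measurable_fun setT v ->
  \int[pi]_x ((trunc u n x)%:E * markov_op p (EFin \o trunc v n) x)
    @[n --> \oo] --> \int[pi]_x ((u x)%:E * markov_op p (EFin \o v) x).
Proof.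
move=> u0 mu v0 mv.
rewrite [X in _ --> X](_ : _ = \int[pi]_x limn
    (fun n => (trunc u n x)%:E * markov_op p (EFin \o trunc v n) x)); last first.
  apply: eq_integral => x _; apply/esym/cvg_lim => //.
  (* For fixed x the first factor is eventually the real constant [u x], so no indeterminate product
     of limits arises. *)
  apply: (@cvg_trans _ ((u x)%:E * markov_op p (EFin \o trunc v n) x @[n --> \oo])).
    apply: near_eq_cvg.
    by have := trunc_near u x; apply: filterS => n /= ->.
  by apply: cvgeZl => //; exact: markov_trunc_cvg.
apply: cvg_monotone_convergence => //.
- move=> n; apply: emeasurable_funM.
    by apply/measurable_EFinP; exact: measurable_trunc.
  apply: measurable_markov_op; apply/measurable_EFinP; exact: measurable_trunc.
- move=> n x _; rewrite mule_ge0 ?lee_fin ?trunc_ge0//.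
  by apply: markov_ge0 => y; rewrite lee_fin trunc_ge0.
- move=> x _ m n mn; apply: lee_pmul.
  + by rewrite lee_fin trunc_ge0.
  + by apply: markov_ge0 => y; rewrite lee_fin trunc_ge0.
  + by rewrite lee_fin nd_trunc.
  + apply: ge0_le_integral => //.
    * by move=> y _; rewrite lee_fin trunc_ge0.
    * by apply/measurable_EFinP; exact: measurable_trunc.
    * by apply/measurable_EFinP; exact: measurable_trunc.
    * by move=> y _; rewrite lee_fin nd_trunc.
Qed.

(** Reversibility of the truncations passes to the limit, both sides being possibly infinite. It is
    meant for [V], which may lie outside L^2(pi). *)
Lemma ge0_reversible (u v : X -> R) : (forall x, 0 <= u x)%R ->
  measurable_fun setT u ->
  (forall x, 0 <= v x)%R -> measurable_fun setT v ->
  \int[pi]_x ((u x)%:E * markov_op p (EFin \o v) x) =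
  \int[pi]_x ((v x)%:E * markov_op p (EFin \o u) x).
Proof.
move=> u0 mu v0 mv.
have cu := inner_trunc_cvg u0 mu v0 mv.
have cv := inner_trunc_cvg v0 mv u0 mu.
apply: cvg_unique cu _ => //.
rewrite (_ : (fun n => _) = (fun n =>
   \int[pi]_x ((trunc v n x)%:E * markov_op p (EFin \o trunc u n) x)))//.
apply/funext => n.
have := rev (trunc_Lfun2 n u0 mu) (trunc_Lfun2 n v0 mv).
rewrite /inner_L2 => ->.
by apply: eq_integral => x _; rewrite muleC.
Qed.

(** Reversibility paired with the constant 1, since P 1 = 1. *)
Lemma ge0_invariant (v : X -> R) : (forall x, 0 <= v x)%R ->
  measurable_fun setT v ->
  \int[pi]_x markov_op p (EFin \o v) x = \int[pi]_x (v x)%:E.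
Proof.
move=> v0 mv.
have /= := @ge0_reversible (cst 1%R) v _ _ v0 mv.
under eq_integral do rewrite mul1e.
move=> -> //; apply: eq_integral => x _.
by rewrite /markov_op [X in _ * X]integral_cst_probability ?mule1//; exact: prob_kernel.
Qed.

End reversible_kernel.

(** * The Markov operator and its Dirichlet form on L^2(pi) *)

Section markov_L2.
Context d (X : measurableType d) (R : realType) (p : R.-pker X ~> X)
  (pi : probability X R).
Implicit Types f g h : X -> R.

Definition ip f g : R := (\int[pi]_x (f x * g x))%R.

(* [fine] sends infinite or undefined integrals to [0]; for f in L^2(pi) this only
   happens on a pi-negligible set ([ae_markov_oprE]). *)
Definition markov_opr f : X -> R := fun x => fine (markov_op p (EFin \o f) x).

(* Twice the Dirichlet form. *)
Definition dirichlet f : \bar R :=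
  (\int[pi]_x \int[p x]_y ((f x - f y) ^+ 2)%:E)%E.

Local Open Scope ereal_scope.

Hypothesis rev : reversible p pi.

Let p1 x : p x [set: X] = 1. Proof. exact: prob_kernel. Qed.

Lemma Lfun2_measurable (mu : {measure set X -> \bar R}) f :
  f \in Lfun mu 2%:E -> measurable_fun setT f.
Proof. by case/Lfun2P. Qed.

Lemma integral_ip f g : f \in Lfun pi 2%:E -> g \in Lfun pi 2%:E ->
  \int[pi]_x (f x * g x)%:E = (ip f g)%:E.
Proof.
move=> fL gL; rewrite /ip /Rintegral fineK//.
by apply: integrable_fin_num => //; exact: Lfun2_integrableM.
Qed.

Lemma integral_sqr f : f \in Lfun pi 2%:E ->
  \int[pi]_x (f x ^+ 2)%:E = (ip f f)%:E.
Proof. by move=> fL; rewrite -integral_ip. Qed.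

Lemma ip_sym f g : ip f g = ip g f.
Proof. by rewrite /ip; under eq_Rintegral do rewrite mulrC. Qed.

Lemma ip_ge0 f : (0 <= ip f f)%R.
Proof. by apply: Rintegral_ge0 => x _; rewrite -expr2 sqr_ge0. Qed.

Lemma ip_combl f g h (a : R) : f \in Lfun pi 2%:E -> g \in Lfun pi 2%:E ->
  h \in Lfun pi 2%:E ->
  (ip (fun x => f x + a * g x) h = ip f h + a * ip g h)%R.
Proof.
move=> fL gL hL; rewrite /ip -RintegralZl//; last exact: Lfun2_integrableM.
rewrite -RintegralD//.
- by apply: eq_Rintegral => x _; rewrite mulrDl mulrA.
- exact: Lfun2_integrableM.
- rewrite (_ : _ \o _ = fun x => a%:E * (g x * h x)%:E)//.
  by apply: integrableZl => //; exact: Lfun2_integrableM.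
Qed.

Lemma ip_combr f g h (a : R) : f \in Lfun pi 2%:E -> g \in Lfun pi 2%:E ->
  h \in Lfun pi 2%:E ->
  (ip h (fun x => f x + a * g x) = ip h f + a * ip h g)%R.
Proof. by move=> fL gL hL; rewrite ip_sym ip_combl// !(ip_sym h). Qed.

Lemma markov_op_sqr_integrable f : f \in Lfun pi 2%:E ->
  pi.-integrable setT (markov_op p (EFin \o (fun x => f x ^+ 2)%R)).
Proof.
move=> /Lfun2P[mf fi]; apply/integrableP; split.
  by apply: measurable_markov_op; apply/measurable_EFinP; exact: measurable_funX.
rewrite (eq_integral (markov_op p (EFin \o (fun x => f x ^+ 2)%R))).
  by rewrite ge0_invariant// => [x|]; [exact: sqr_ge0|exact: measurable_funX].
move=> x _; rewrite gee0_abs//; apply: integral_ge0 => y _.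
by rewrite lee_fin sqr_ge0.
Qed.

(** P(f^2) is integrable by invariance, hence finite almost everywhere; at such x the integral
    defining P f(x) is finite. *)
Lemma ae_Lfun2 f : f \in Lfun pi 2%:E ->
  {ae pi, forall x, f \in Lfun (p x) 2%:E}.
Proof.
move=> fL; have := integrable_ae measurableT (markov_op_sqr_integrable fL).
apply: filterS => x /(_ I) fin; apply/Lfun2P.
by split; [exact: Lfun2_measurable fL|rewrite ltey_eq fin].
Qed.

Lemma markov_oprE f x : f \in Lfun (p x) 2%:E ->
  markov_op p (EFin \o f) x = (markov_opr f x)%:E.
Proof.
move=> fL; rewrite /markov_opr fineK//.
by apply: integrable_fin_num => //; exact: Lfun2_integrable.
Qed.

Lemma ae_markov_oprE f : f \in Lfun pi 2%:E ->
  {ae pi, forall x, markov_op p (EFin \o f) x = (markov_opr f x)%:E}.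
Proof. by move=> /ae_Lfun2; apply: filterS => x; exact: markov_oprE. Qed.

Lemma measurable_markov_opr f : measurable_fun setT f ->
  measurable_fun setT (markov_opr f).
Proof.
move=> mf; apply: (measurableT_comp (fine_measurable measurableT)).
by apply: measurable_markov_op; exact/measurable_EFinP.
Qed.

(** Serves the tangent line in Jensen's inequality and the cross term of the Dirichlet form, both
    affine in [f y]. *)
Lemma markov_op_affine f (a c : R) x : f \in Lfun (p x) 2%:E ->
  \int[p x]_y (a * f y + c)%:E = (a * markov_opr f x + c)%:E.
Proof.
move=> fL; have fi := Lfun2_integrable (p1 x) fL.
under eq_integral do rewrite EFinD EFinM.
rewrite integralD//; last 2 first.
- by apply: integrableZl.
- by apply: (Lfun2_integrable (p1 x)); apply/Lfun2P; split => //;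
    rewrite integral_cst_probability// ltry.
by rewrite integralZl// integral_cst_probability// EFinD EFinM -markov_oprE.
Qed.

Lemma markov_opr_sqr_le f x : f \in Lfun (p x) 2%:E ->
  (markov_opr f x ^+ 2)%:E <= markov_op p (EFin \o (fun x => f x ^+ 2)%R) x.
Proof.
move=> fL; set m := markov_opr f x.
(* Jensen through the tangent at m: 2 m t - m^2 <= t^2 for every t, and at t = f y the left side
   integrates to m^2 under [p x]. *)
have -> : (m ^+ 2)%:E = \int[p x]_y ((2 * m) * f y + - m ^+ 2)%:E.
  by rewrite markov_op_affine// -/m; congr EFin; ring.
apply: le_integral => //.
- apply: (Lfun2_integrable (p1 x)).
  under eq_fun do rewrite addrC.
  apply: Lfun2_comb => //; apply/Lfun2P; split => //.
  by rewrite integral_cst_probability// ltry.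
- by have := Lfun2_integrableM fL fL.
- move=> y _; rewrite lee_fin -subr_ge0.
  by rewrite (_ : _ - _ = (f y - m) ^+ 2)%R ?sqr_ge0//; ring.
Qed.

(** Jensen bounds (P f)^2 almost everywhere by P(f^2), whose integral is finite by invariance. *)
Lemma markov_opr_Lfun2 f : f \in Lfun pi 2%:E -> markov_opr f \in Lfun pi 2%:E.
Proof.
move=> fL; have mf := Lfun2_measurable fL.
have mPf := measurable_markov_opr mf.
apply/Lfun2P; split => //.
have /integrableP[mPf2 +] := markov_op_sqr_integrable fL.
apply: le_lt_trans; apply: ae_ge0_le_integral => //.
- by move=> x _; rewrite lee_fin sqr_ge0.
- by apply/measurable_EFinP; exact: measurable_funX.
- exact: measurableT_comp.
- have := ae_Lfun2 fL; apply: filterS => x fx _.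
  by apply: le_trans (markov_opr_sqr_le fx) _; exact: lee_abs.
Qed.

Lemma ip_markovE f g : f \in Lfun pi 2%:E -> g \in Lfun pi 2%:E ->
  inner_L2 pi (EFin \o f) (markov_op p (EFin \o g)) = (ip f (markov_opr g))%:E.
Proof.
move=> fL gL; rewrite -integral_ip ?markov_opr_Lfun2//.
have mf := Lfun2_measurable fL; have mg := Lfun2_measurable gL.
apply: ae_eq_integral => //.
- apply: emeasurable_funM; first exact/measurable_EFinP.
  by apply: measurable_markov_op; exact/measurable_EFinP.
- by apply/measurable_EFinP; apply: measurable_funM => //; exact: measurable_markov_opr.
- by have := ae_markov_oprE gL; apply: filterS => x /= -> _.
Qed.

Lemma ip_markov_sym f g : f \in Lfun pi 2%:E -> g \in Lfun pi 2%:E ->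
  ip f (markov_opr g) = ip (markov_opr f) g.
Proof.
move=> fL gL; apply: EFin_inj; rewrite -ip_markovE// rev// ip_sym -ip_markovE//.
by apply: eq_integral => x _; rewrite muleC.
Qed.

Lemma ip_eq_ae f g h : f \in Lfun pi 2%:E -> g \in Lfun pi 2%:E ->
  h \in Lfun pi 2%:E -> {ae pi, forall x, g x = h x} -> ip f g = ip f h.
Proof.
move=> fL gL hL gh; apply: EFin_inj; rewrite -!integral_ip//.
have mf := Lfun2_measurable fL; have mg := Lfun2_measurable gL.
have mh := Lfun2_measurable hL.
apply: ae_eq_integral => //; last by apply: filterS gh => x -> _.
- by apply/measurable_EFinP; exact: measurable_funM.
- by apply/measurable_EFinP; exact: measurable_funM.
Qed.

Lemma markov_opr_comb f g (a : R) : f \in Lfun pi 2%:E -> g \in Lfun pi 2%:E ->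
  {ae pi, forall x, markov_opr (fun x => f x + a * g x)%R x =
                    (markov_opr f x + a * markov_opr g x)%R}.
Proof.
move=> fL gL; have := ae_Lfun2 fL; have := ae_Lfun2 gL.
apply: filterS2 => x gx fx.
have fi := Lfun2_integrable (p1 x) fx; have gi := Lfun2_integrable (p1 x) gx.
apply: EFin_inj; rewrite -markov_oprE ?Lfun2_comb// EFinD EFinM -!markov_oprE//.
rewrite /markov_op -integralZl// -integralD//; exact: integrableZl.
Qed.

Lemma measurable_markov_sqrB f : measurable_fun setT f ->
  measurable_fun setT (fun x => \int[p x]_y ((f x - f y) ^+ 2)%:E).
Proof.
move=> mf.
apply: (@measurable_markov2 _ _ _ p (fun z => ((f z.1 - f z.2) ^+ 2)%:E)).
  by move=> z; rewrite lee_fin sqr_ge0.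
apply/measurable_EFinP; apply: measurable_funX.
by apply: measurable_funB; exact: measurableT_comp.
Qed.

(** Expanding the square, the inner integral is f^2 - 2 f P f + P(f^2) for almost every x, and by
    invariance the last term contributes a second <f, f>. *)
Lemma dirichletE f : f \in Lfun pi 2%:E ->
  dirichlet f = (2 * ip f f - 2 * ip f (markov_opr f))%:E.
Proof.
move=> fL; have PfL := markov_opr_Lfun2 fL.
have mf := Lfun2_measurable fL; have mPf := Lfun2_measurable PfL.
have i1 := Lfun2_integrableM fL fL.
have i2 := Lfun2_integrableM fL PfL.
have i3 := markov_op_sqr_integrable fL.
have i4 : pi.-integrable setT
    (fun x => (f x * f x)%:E - 2%:E * (f x * markov_opr f x)%:E).
  by apply: integrableB => //; exact: integrableZl.
rewrite /dirichlet (@ae_eq_integral _ _ _ pi setT (fun x =>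
    ((f x * f x)%:E - 2%:E * (f x * markov_opr f x)%:E) +
    markov_op p (EFin \o (fun x => f x ^+ 2)%R) x))//.
- rewrite integralD// integralB//; last exact: integrableZl.
  rewrite integralZl// !integral_ip// ge0_invariant//; last 2 first.
  + by move=> x; exact: sqr_ge0.
  + exact: measurable_funX.
  by rewrite integral_sqr// -!EFinD; congr EFin; ring.
- exact: measurable_markov_sqrB.
- by apply: emeasurable_funD; [case/integrableP: i4|case/integrableP: i3].
- have := ae_Lfun2 fL; apply: filterS => x fx _.
  rewrite -EFinM -EFinB.
  rewrite (_ : (_ - _)%R = ((- 2 * f x) * markov_opr f x + f x * f x)%R);
    last by ring.
  rewrite -markov_op_affine// /markov_op -integralD//.
  + by apply: eq_integral => y _; rewrite -EFinD; congr EFin; rewrite /=; ring.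
  + apply: (Lfun2_integrable (p1 x)).
    under eq_fun do rewrite addrC.
    apply: Lfun2_comb => //; apply/Lfun2P; split => //.
    by rewrite integral_cst_probability// ltry.
  + by have := Lfun2_integrableM fx fx.
Qed.

End markov_L2.

(** * From a bound on the quadratic form to a bound on the operator norm *)

Section spectral_gap.
Context d (X : measurableType d) (R : realType) (p : R.-pker X ~> X)
  (pi : probability X R).
Implicit Types f g h : X -> R.

Local Open Scope ereal_scope.

Hypothesis rev : reversible p pi.

Lemma Lnorm2_ip f : f \in Lfun pi 2%:E ->
  'N[pi]_2%:E[EFin \o f] = (Num.sqrt (ip pi f f))%:E.
Proof.
by move=> fL; rewrite Lnorm2_EFin integral_sqr//= powR12_sqrt ?ip_ge0.
Qed.

Lemma Lnorm2_markov f : f \in Lfun pi 2%:E ->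
  'N[pi]_2%:E[markov_op p (EFin \o f)] =
  (Num.sqrt (ip pi (markov_opr p f) (markov_opr p f)))%:E.
Proof.
move=> fL; have PfL := markov_opr_Lfun2 rev fL.
have mf := Lfun2_measurable fL; have mPf := Lfun2_measurable PfL.
rewrite -Lnorm2_ip// unlock; congr (_ `^ _).
apply: ae_eq_integral => //.
- apply: (@measurableT_comp _ _ _ _ _ _ (fun x => x `^ 2) _
    (fun x => `|markov_op p (EFin \o f) x|)).
    exact: measurable_poweR.
  apply: measurableT_comp => //.
  by apply: measurable_markov_op; exact/measurable_EFinP.
- apply: (@measurableT_comp _ _ _ _ _ _ (fun x => x `^ 2) _
    (fun x => `|(EFin \o markov_opr p f) x|)).
    exact: measurable_poweR.
  by apply: measurableT_comp => //; exact/measurable_EFinP.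
- by have := ae_markov_oprE rev fL; apply: filterS => x -> _.
Qed.

(** Makes the denominators in the operator norm positive. *)
Lemma ip_eq0_ae f : f \in Lfun pi 2%:E -> ip pi f f = 0%R -> f = cst 0%R %[ae pi].
Proof.
move=> fL f0; have mf := Lfun2_measurable fL.
have : \int[pi]_x `|(f x ^+ 2)%:E| = 0.
  under eq_integral do rewrite gee0_abs ?lee_fin ?sqr_ge0//.
  by rewrite integral_sqr// f0.
move/ae_eq_integral_abs => /(_ measurableT).
have mf2 : measurable_fun setT (fun x => (f x ^+ 2)%:E).
  by apply/measurable_EFinP; exact: measurable_funX.
move=> /(_ mf2); apply: filterS => x /= /(_ I) [] /eqP.
by rewrite sqrf_eq0 => /eqP.
Qed.

(** <1, P f> = <P 1, f> = <1, f> = 0. This allows the form bound to be applied to P f itself. *)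
Lemma markov_opr_L2_0 f : L2_0 pi f -> L2_0 pi (markov_opr p f).
Proof.
move=> [fL f0]; have PfL := markov_opr_Lfun2 rev fL.
have oneL : cst 1%R \in Lfun pi 2%:E by exact: Lfun_cst.
split => //.
rewrite -[RHS]f0.
transitivity ((ip pi (cst 1%R) (markov_opr p f))%:E).
  by rewrite -integral_ip//; apply: eq_integral => x _; rewrite mul1r.
rewrite (ip_markov_sym rev)//.
rewrite -(integral_ip (markov_opr_Lfun2 rev oneL))//.
apply: eq_integral => x _; rewrite /markov_opr /markov_op.
have -> : \int[p x]_y (EFin \o cst 1%R) y = 1.
  by apply: integral_cst_probability; exact: prob_kernel.
by rewrite mul1r.
Qed.

(* <f - t Pf, P(f - t Pf)> >= 0 at t = 1/r, or at t = 1 when r = 0. *)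
Lemma markov_opr_norm_le (r : R) : pos_semidef_L2 p pi -> (0 <= r)%R ->
  (forall f, L2_0 pi f -> ip pi f (markov_opr p f) <= r * ip pi f f)%R ->
  forall f, L2_0 pi f ->
  (ip pi (markov_opr p f) (markov_opr p f) <= r ^+ 2 * ip pi f f)%R.
Proof.
move=> psd r0 Pr f f0; have fL := f0.1.
set g := markov_opr p f.
have g0 : L2_0 pi g := markov_opr_L2_0 f0.
have gL := g0.1.
have PgL : markov_opr p g \in Lfun pi 2%:E by exact: markov_opr_Lfun2.
have disc t :
    (0 <= ip pi f g - 2 * t * ip pi g g + t ^+ 2 * ip pi g (markov_opr p g))%R.
  pose h x := (f x + (- t) * g x)%R.
  have hL : h \in Lfun pi 2%:E by exact: Lfun2_comb.
  have := psd _ hL; rewrite ip_markovE// lee_fin.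
  rewrite (@ip_eq_ae _ _ _ pi h (markov_opr p h)
    (fun x => markov_opr p f x + (- t) * markov_opr p g x)%R)//.
  - rewrite ip_combr// !ip_combl// -/g.
    (* By symmetry <f, P g> = <P f, g> = <g, g>, so both cross terms agree. *)
    rewrite (ip_markov_sym rev fL gL) -/g.
    by congr (0 <= _)%R; ring.
  - exact: markov_opr_Lfun2.
  - exact: Lfun2_comb.
  - exact: markov_opr_comb.
have fg := Pr _ f0; have gg := Pr _ g0; rewrite -/g in fg.
have G0 := ip_ge0 pi g.
have [r_eq0|rN0] := eqVneq r 0%R.
  rewrite r_eq0 mul0r in fg; rewrite r_eq0 mul0r in gg.
  by have := disc 1%R; rewrite r_eq0; nra.
have rp : (0 < r)%R by rewrite lt_def rN0.
have := disc r^-1%R; set t := (r^-1)%R => H.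
have tr : (t * r = 1)%R by rewrite mulVf.
have t0 : (0 < t)%R by rewrite invr_gt0.
(* The form bound at g = P f absorbs the quadratic term into half of the linear one, leaving t <g,
   g> <= <f, g>. *)
have H2 : (t ^+ 2 * ip pi g (markov_opr p g) <= t * ip pi g g)%R.
  rewrite expr2 -mulrA ler_pM2l//.
  by rewrite (le_trans (ler_wpM2l (ltW t0) gg))// mulrA tr mul1r.
have H3 : (t * ip pi g g <= r * ip pi f f)%R by lra.
rewrite expr2 -mulrA -(ler_pM2l t0) [leRHS]mulrA tr mul1r//.
Qed.

(** [0 <= r] covers the value 0 adjoined to the supremum and lets r be written as the square root of
    [r ^+ 2]. *)
Lemma opnorm_L2_0_le (r : R) : pos_semidef_L2 p pi -> (0 <= r)%R ->
  (forall f, L2_0 pi f -> ip pi f (markov_opr p f) <= r * ip pi f f)%R ->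
  opnorm_L2_0 p pi <= r%:E.
Proof.
move=> psd r0 Pr; apply: ge_ereal_sup => _ [->|[f [f0 fN0] <-]].
  by rewrite lee_fin.
have fL := f0.1; rewrite Lnorm2_markov// Lnorm2_ip//.
have ff0 : (0 < ip pi f f)%R.
  rewrite lt_def ip_ge0 andbT; apply/eqP => ff0.
  by apply: fN0; exact: ip_eq0_ae.
rewrite inver gt_eqF ?sqrtr_gt0// -EFinM lee_fin ler_pdivrMr ?sqrtr_gt0//.
rewrite -[r]ger0_norm// -sqrtr_sqr -sqrtrM ?sqr_ge0//.
by apply: ler_wsqrtr; exact: markov_opr_norm_le.
Qed.

End spectral_gap.

(** * The drift condition against the Dirichlet form *)

Section lyapunov.
Context d (X : measurableType d) (R : realType) (p : R.-pker X ~> X)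
  (pi : probability X R) (V : X -> R) (b lambda : R) (K : set X).
Implicit Types f g h : X -> R.

Hypothesis rev : reversible p pi.
Hypothesis mV : measurable_fun setT V.
Hypothesis V_ge1 : forall x, 1 <= V x.
Hypothesis b_ge0 : 0 <= b.
Hypothesis lambda_ge0 : 0 <= lambda.
Hypothesis mK : measurable K.
Hypothesis drift : forall x, (markov_op p (EFin \o V) x
  <= ((1 - lambda) * V x + b * \1_K x)%:E)%E.

Let V_gt0 x : 0 < V x. Proof. exact: lt_le_trans (V_ge1 x). Qed.

Local Open Scope ereal_scope.

(** The weight for which drift is effective: multiplied by [V] it gives back g^2, and it is at most
    g^2 because [V] is at least 1. *)
Let wsqr g x : R := (g x ^+ 2 / V x)%R.

Let wsqr_ge0 g x : (0 <= wsqr g x)%R.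
Proof. by rewrite divr_ge0 ?sqr_ge0// ltW. Qed.

Let measurable_wsqr g : measurable_fun setT g -> measurable_fun setT (wsqr g).
Proof.
move=> mg; apply: measurable_funM; first exact: measurable_funX.
rewrite (_ : (fun x => _) = (fun x => V x `^ (-1))%R).
  exact: (measurableT_comp (measurable_powR _)).
by apply/funext => x; rewrite powR_inv1// ltW.
Qed.

(* The difference of the two sides is a square divided by V x * V y. *)
Let cross_le g x y :
  (g x ^+ 2 + g y ^+ 2 <= (g x - g y) ^+ 2 + (wsqr g x * V y + V x * wsqr g y))%R.
Proof.
have Vx := V_gt0 x; have Vy := V_gt0 y.
rewrite -subr_ge0 [leRHS](_ : _ = ((g x * V y - g y * V x) ^+ 2 / (V x * V y))%R).
  by rewrite divr_ge0 ?sqr_ge0// mulr_ge0// ltW.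
by rewrite /wsqr; field; rewrite !gt_eqF.
Qed.

Let measurable_sqrB g x : measurable_fun setT g ->
  measurable_fun setT (fun y => ((g x - g y) ^+ 2)%:E).
Proof.
by move=> mg; apply/measurable_EFinP; apply: measurable_funX; exact: measurable_funB.
Qed.

Let markov_op_ge0 g x : (forall y, 0 <= g y)%R -> 0 <= markov_op p (EFin \o g) x.
Proof. by move=> g0; apply: integral_ge0 => y _; rewrite lee_fin. Qed.

(** [cross_le] integrated in y against [p x]. All terms are nonnegative and stay on the side where
    they are added, so infinite values are harmless. *)
Let markov_cross_le g x : measurable_fun setT g ->
  (g x ^+ 2)%:E + markov_op p (EFin \o (fun y => g y ^+ 2)%R) x <=
  \int[p x]_y ((g x - g y) ^+ 2)%:E +
   ((wsqr g x)%:E * markov_op p (EFin \o V) x +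
    (V x)%:E * markov_op p (EFin \o wsqr g) x).
Proof.
move=> mg; have mw := measurable_wsqr mg.
have mg2 : measurable_fun setT (fun y => g y ^+ 2)%R by exact: measurable_funX.
have [Vx0 wx0] := (ltW (V_gt0 x), wsqr_ge0 g x).
rewrite /markov_op -ge0_integralZl_EFin//; last 2 first.
- by move=> y _; rewrite lee_fin ltW.
- exact/measurable_EFinP.
rewrite -ge0_integralZl_EFin//; last 2 first.
- by move=> y _; rewrite lee_fin wsqr_ge0.
- exact/measurable_EFinP.
have m1 : measurable_fun setT (fun y => (wsqr g x)%:E * (EFin \o V) y).
  by apply: emeasurable_funM => //; exact/measurable_EFinP.
have m2 : measurable_fun setT (fun y => (V x)%:E * (EFin \o wsqr g) y).
  by apply: emeasurable_funM => //; exact/measurable_EFinP.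
have w0 y : 0 <= (wsqr g x)%:E * (EFin \o V) y.
  by rewrite lee_fin mulr_ge0// ltW.
have v0 y : 0 <= (V x)%:E * (EFin \o wsqr g) y.
  by rewrite lee_fin mulr_ge0.
rewrite -[X in X + _ <= _](integral_cst_probability (g x ^+ 2) (prob_kernel (s:=p) x)).
rewrite -!ge0_integralD//; last 7 first.
- by move=> y _; rewrite lee_fin sqr_ge0.
- exact: measurable_sqrB.
- by move=> y _; rewrite adde_ge0.
- exact: emeasurable_funD.
- by move=> y _; rewrite lee_fin sqr_ge0.
- by move=> y _; rewrite lee_fin sqr_ge0.
- exact/measurable_EFinP.
apply: ge0_le_integral => //.
- by move=> y _; rewrite -EFinD lee_fin addr_ge0 ?sqr_ge0.
- by apply: emeasurable_funD => //; exact/measurable_EFinP.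
- apply: emeasurable_funD; first exact: measurable_sqrB.
  exact: emeasurable_funD.
- by move=> y _; rewrite -!EFinM -!EFinD lee_fin; exact: cross_le.
Qed.

Let ksqr g : \bar R := \int[pi]_x (g x ^+ 2 * \1_K x)%:E.

(** Drift multiplied by g^2/V, with b 1_K g^2/V bounded by b 1_K g^2. The [lambda] term stands on
    the left to avoid subtracting extended reals. *)
Let drift_wsqr_le g : measurable_fun setT g ->
  \int[pi]_x ((wsqr g x)%:E * markov_op p (EFin \o V) x) +
    lambda%:E * \int[pi]_x (g x ^+ 2)%:E <=
  \int[pi]_x (g x ^+ 2)%:E + b%:E * ksqr g.
Proof.
move=> mg; have mw := measurable_wsqr mg.
have mg2 : measurable_fun setT (fun y => g y ^+ 2)%R by exact: measurable_funX.
have mgK : measurable_fun setT (fun y => g y ^+ 2 * \1_K y)%R.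
  exact: measurable_funM.
have PV0 x : 0 <= markov_op p (EFin \o V) x.
  by apply: markov_op_ge0 => y; rewrite ltW.
have m1 : measurable_fun setT
    (fun x => (wsqr g x)%:E * markov_op p (EFin \o V) x).
  apply: emeasurable_funM; first exact/measurable_EFinP.
  by apply: measurable_markov_op; exact/measurable_EFinP.
have m2 : measurable_fun setT (fun x => lambda%:E * (g x ^+ 2)%:E).
  by apply: emeasurable_funM => //; exact/measurable_EFinP.
have m3 : measurable_fun setT (fun x => b%:E * (g x ^+ 2 * \1_K x)%:E).
  by apply: emeasurable_funM => //; exact/measurable_EFinP.
have gK0 x : (0 <= g x ^+ 2 * \1_K x)%R by rewrite mulr_ge0 ?sqr_ge0.
have w0 x : 0 <= (wsqr g x)%:E * markov_op p (EFin \o V) x.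
  by rewrite mule_ge0 ?lee_fin.
rewrite /ksqr -!ge0_integralZl_EFin//; last 4 first.
- by move=> y _; rewrite lee_fin.
- exact/measurable_EFinP.
- by move=> y _; rewrite lee_fin sqr_ge0.
- exact/measurable_EFinP.
rewrite -!ge0_integralD//; last 4 first.
- by move=> y _; rewrite lee_fin sqr_ge0.
- exact/measurable_EFinP.
- by move=> y _; rewrite lee_fin mulr_ge0.
- by move=> y _; rewrite lee_fin mulr_ge0 ?sqr_ge0.
apply: ge0_le_integral => //.
- by move=> x _; rewrite adde_ge0// lee_fin mulr_ge0 ?sqr_ge0.
- exact: emeasurable_funD.
- by apply: emeasurable_funD => //; exact/measurable_EFinP.
move=> x _.
have wV : (wsqr g x * V x = g x ^+ 2)%R by rewrite divfK// gt_eqF.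
have wg : (wsqr g x <= g x ^+ 2)%R.
  by rewrite ler_pdivrMr// ler_peMr ?sqr_ge0.
have wx0 : 0 <= (wsqr g x)%:E by rewrite lee_fin.
have := lee_wpmul2l wx0 (drift x).
rewrite -!EFinM.
move=> /(leeD2r (lambda * g x ^+ 2)%:E)/le_trans; apply.
rewrite -!EFinD lee_fin.
have : (b * \1_K x * wsqr g x <= b * \1_K x * g x ^+ 2)%R.
  by rewrite ler_wpM2l ?mulr_ge0.
rewrite -wV; nra.
Qed.

Let integral_cross_le g : measurable_fun setT g ->
  \int[pi]_x (g x ^+ 2)%:E + \int[pi]_x (g x ^+ 2)%:E <= dirichlet p pi g +
  (\int[pi]_x ((wsqr g x)%:E * markov_op p (EFin \o V) x) +
   \int[pi]_x ((wsqr g x)%:E * markov_op p (EFin \o V) x)).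
Proof.
move=> mg; have mw := measurable_wsqr mg.
have mg2 : measurable_fun setT (fun y => g y ^+ 2)%R by exact: measurable_funX.
have g20 x : (0 <= g x ^+ 2)%R by rewrite sqr_ge0.
have V0 x : (0 <= V x)%R by rewrite ltW.
have w0 := wsqr_ge0 g.
(* Reversibility exchanges [V] and g^2/V, so both cross terms become the integral of (g^2/V) PV;
   invariance replaces one g^2 by P(g^2). *)
rewrite [X in _ <= _ + (_ + X)](ge0_reversible rev)//.
rewrite -[X in _ + X <= _](ge0_invariant rev)// /dirichlet.
have mP h : measurable_fun setT h -> measurable_fun setT (markov_op p (EFin \o h)).
  by move=> mh; apply: measurable_markov_op; exact/measurable_EFinP.
have mm h k : measurable_fun setT h -> measurable_fun setT k ->
    measurable_fun setT (fun x => (h x)%:E * markov_op p (EFin \o k) x).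
  by move=> mh mk; apply: emeasurable_funM; [exact/measurable_EFinP|exact: mP].
have mm0 h k x : (forall y, 0 <= h y)%R -> (forall y, 0 <= k y)%R ->
    0 <= (h x)%:E * markov_op p (EFin \o k) x.
  by move=> h0 k0; rewrite mule_ge0 ?lee_fin//; exact: markov_op_ge0.
have D0 x : 0 <= \int[p x]_y ((g x - g y) ^+ 2)%:E.
  by apply: integral_ge0 => y _; rewrite lee_fin sqr_ge0.
have mD : measurable_fun setT (fun x => \int[p x]_y ((g x - g y) ^+ 2)%:E).
  exact: measurable_markov_sqrB.
rewrite -!ge0_integralD//; last 10 first.
- by move=> x _; rewrite adde_ge0//; exact: mm0.
- by apply: emeasurable_funD; exact: mm.
- by move=> x _; exact: mm0.
- exact: mm.
- by move=> x _; exact: mm0.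
- exact: mm.
- by move=> x _; rewrite lee_fin.
- exact/measurable_EFinP.
- by move=> x _; exact: markov_op_ge0.
- exact: mP.
apply: ge0_le_integral => //.
- by move=> x _; rewrite adde_ge0 ?lee_fin//; exact: markov_op_ge0.
- by apply: emeasurable_funD; [exact/measurable_EFinP|exact: mP].
- by apply: emeasurable_funD => //; apply: emeasurable_funD; exact: mm.
- by move=> x _; exact: markov_cross_le.
Qed.

(** Twice [drift_wsqr_le] combined with [integral_cross_le]; the factors 2 reflect that [dirichlet]
    is twice the Dirichlet form. *)
Lemma lyapunov_dirichlet_le g : g \in Lfun pi 2%:E ->
  (2 * (lambda * ip pi g g))%:E <=
  dirichlet p pi g + 2%:E * (b%:E * \int[pi]_x (g x ^+ 2 * \1_K x)%:E).
Proof.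
move=> gL; have mg := Lfun2_measurable gL.
have mg2 : measurable_fun setT (fun y => g y ^+ 2)%R by exact: measurable_funX.
have S := integral_sqr gL.
have [D0 D_E] : 0 <= dirichlet p pi g /\ dirichlet p pi g \is a fin_num.
  split; last by rewrite dirichletE.
  by apply: integral_ge0 => x _; apply: integral_ge0 => y _; rewrite lee_fin sqr_ge0.
have A0 : 0 <= \int[pi]_x ((wsqr g x)%:E * markov_op p (EFin \o V) x).
  apply: integral_ge0 => x _; rewrite mule_ge0 ?lee_fin//.
  by apply: markov_op_ge0 => y; rewrite ltW.
have K0 : 0 <= ksqr g.
  by apply: integral_ge0 => x _; rewrite lee_fin mulr_ge0 ?sqr_ge0.
have K_E : ksqr g \is a fin_num.
  rewrite ge0_fin_numE// (@le_lt_trans _ _ (ip pi g g)%:E) ?ltry// -S.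
  apply: ge0_le_integral => //.
  - by move=> x _; rewrite lee_fin mulr_ge0 ?sqr_ge0.
  - by apply/measurable_EFinP; apply: measurable_funM.
  - exact/measurable_EFinP.
  - move=> x _; rewrite lee_fin indicE.
    by case: (_ \in _); rewrite ?mulr1 ?mulr0 ?sqr_ge0.
have dl := drift_wsqr_le mg.
have cl := integral_cross_le mg.
move: A0 dl cl K0 K_E; rewrite -/(ksqr g) S.
set A := \int[pi]_x _; move=> A0 dl cl K0 K_E.
(* [A] occurs in both inequalities and can be cancelled only once it is finite; the drift bound
   gives this. *)
have A_E : A \is a fin_num.
  rewrite ge0_fin_numE// (le_lt_trans _ (_ : (ip pi g g)%:E + b%:E * ksqr g < +oo))//.
    by apply: le_trans dl; rewrite leeDl// mule_ge0 ?lee_fin ?ip_ge0.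
  by rewrite -(fineK K_E) -EFinM -EFinD ltry.
move: dl cl; rewrite -(fineK K_E) -(fineK D_E) -(fineK A_E).
rewrite -!EFinM -!EFinD !lee_fin; lra.
Qed.

End lyapunov.

(** * The minorization condition against the Dirichlet form *)

Section minorization.
Context d (X : measurableType d) (R : realType) (p : R.-pker X ~> X)
  (pi nu : probability X R) (alpha : R) (K : set X).

Local Open Scope ereal_scope.

Hypothesis alpha_ge0 : (0 <= alpha)%R.
Hypothesis mK : measurable K.
Hypothesis minor : forall x (A : set X), measurable A ->
  alpha%:E * nu A * (\1_K x)%:E <= markov_op p (EFin \o \1_A) x.

Let markov_op_indic A x : measurable A -> markov_op p (EFin \o \1_A) x = p x A.
Proof. by move=> mA; rewrite /markov_op integral_indic// setIT. Qed.

(** Minorization tested on the whole space. It later ensures that the gap is at most 1. *)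
Lemma minorization_le1 x : K x -> (alpha <= 1)%R.
Proof.
move=> Kx; have := minor x measurableT.
rewrite markov_op_indic// indicE mem_set// mule1.
by rewrite [X in _ * X <= _]probability_setT [leRHS]prob_kernel mule1 lee_fin.
Qed.

(** On [K] the measure [p x] dominates alpha nu on every measurable set, hence on nonnegative
    integrands; off [K] the left side vanishes. *)
Lemma minorization_integral_le (h : X -> \bar R) x : (forall y, 0 <= h y) ->
  measurable_fun setT h ->
  alpha%:E * \int[nu]_y (h y * (\1_K x)%:E) <= \int[p x]_y h y.
Proof.
move=> h0 mh; have [Kx|nKx] := pselect (K x); last first.
  have -> : \1_K x = 0%R :> R by rewrite indicE memNset.
  rewrite [X in _ * X <= _]integral0_eq ?mule0 ?integral_ge0// => y _.
  by rewrite mule0.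
have K1 : \1_K x = 1%R :> R by rewrite indicE mem_set.
rewrite K1; under [X in _ * X <= _]eq_integral do rewrite mule1.
rewrite -(ge0_integral_mscale nu measurableT (NngNum alpha_ge0))//.
apply: ge0_le_measure_integral => // A mA.
have := minor x mA; rewrite markov_op_indic// K1 mule1.
exact: le_trans.
Qed.

(** The previous bound at each x, integrated over pi. Tonelli puts the nu-integral outermost, ready
    for averaging over the shift f(y). *)
Lemma minorization_dirichlet_le (f : X -> R) : measurable_fun setT f ->
  alpha%:E * \int[nu]_y \int[pi]_x ((f x - f y) ^+ 2 * \1_K x)%:E <=
  dirichlet p pi f.
Proof.
move=> mf; pose F z := ((f z.1 - f z.2) ^+ 2 * \1_K z.1)%:E.
have F0 z : 0 <= F z by rewrite lee_fin mulr_ge0 ?sqr_ge0.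
have mF : measurable_fun setT F.
  apply/measurable_EFinP; apply: measurable_funM.
    apply: measurable_funX.
    by apply: measurable_funB; exact: measurableT_comp.
  by apply: measurableT_comp => //; exact: measurable_fst.
rewrite -(fubini_tonelli (m1 := pi) (m2 := nu) F)// /F/=.
rewrite -ge0_integralZl_EFin//; last 2 first.
- by move=> x _; apply: integral_ge0 => y _; exact: (F0 (x, y)).
- exact: (measurable_fun_fubini_tonelli_F (m2 := nu) F).
apply: ge0_le_integral => //.
- move=> x _; rewrite mule_ge0 ?lee_fin//.
  by apply: integral_ge0 => y _; exact: (F0 (x, y)).
- apply: emeasurable_funM => //.
  exact: (measurable_fun_fubini_tonelli_F (m2 := nu) F).
- exact: measurable_markov_sqrB.
- move=> x _; under eq_integral do rewrite EFinM.
  apply: (@minorization_integral_le (fun y => ((f x - f y) ^+ 2)%:E)) => [y|].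
    by rewrite lee_fin sqr_ge0.
  by apply/measurable_EFinP; apply: measurable_funX; exact: measurable_funB.
Qed.

End minorization.

(** * A constraint on the drift constants *)

Section drift.
Context d (X : measurableType d) (R : realType) (p : R.-pker X ~> X).

(* Bound PV from below by m = inf V, and let V x tend to m. *)
Lemma drift_rate_le (V : X -> R) (lambda c : R) : X ->
  measurable_fun setT V -> (forall x, 1 <= V x) -> 0 <= lambda ->
  (forall x, (markov_op p (EFin \o V) x <= ((1 - lambda) * V x + c)%:E)%E) ->
  lambda <= c.
Proof.
move=> x0 mV V1 l0 drift.
pose m := inf (range V).
have Vinf : has_inf (range V).
  by split; [exists (V x0), x0|exists 1 => _ [x _ <-]].
have mle x : m <= V x by apply: ge_inf; [case: Vinf|exists x].
have m1 : 1 <= m by apply: lb_le_inf; [exists (V x0), x0|move=> _ [x _ <-]].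
have mdrift x : m <= (1 - lambda) * V x + c.
  rewrite -lee_fin (le_trans _ (drift x))//.
  rewrite -[leLHS](integral_cst_probability _ (prob_kernel (s:=p) x)).
  apply: ge0_le_integral => //.
  - by move=> y _; rewrite lee_fin (le_trans ler01).
  - exact/measurable_EFinP.
  - by move=> y _; rewrite lee_fin.
(* If [lambda] is at least 1, then (1 - lambda) V x0 <= 1 - lambda suffices. Otherwise (m - c)/(1 -
   lambda) is a lower bound of [V], hence at most m, so lambda m <= c with m >= 1. *)
have [l1|l1] := leP (1 - lambda) 0.
  by have := mdrift x0; have := V1 x0; nra.
have : (m - c) / (1 - lambda) <= m.
  apply: lb_le_inf; first by exists (V x0), x0.
  move=> _ [x _ <-]; rewrite ler_pdivrMr//.
  by have := mdrift x; lra.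
by rewrite ler_pdivrMr//; nra.
Qed.

End drift.

(** * A Poincaré inequality for centred functions *)

Section dirichlet_gap.
Context d (X : measurableType d) (R : realType) (p : R.-pker X ~> X)
  (pi nu : probability X R) (V : X -> R) (b alpha lambda : R) (K : set X).

Hypothesis rev : reversible p pi.
Hypothesis mV : measurable_fun setT V.
Hypothesis V_ge1 : forall x, 1 <= V x.
Hypothesis b_ge0 : 0 <= b.
Hypothesis alpha_gt0 : 0 < alpha.
Hypothesis lambda_ge0 : 0 <= lambda.
Hypothesis mK : measurable K.
Hypothesis drift : forall x, (markov_op p (EFin \o V) x
  <= ((1 - lambda) * V x + b * \1_K x)%:E)%E.
Hypothesis minor : forall x (A : set X), measurable A ->
  (alpha%:E * nu A * (\1_K x)%:E <= markov_op p (EFin \o \1_A) x)%E.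

Local Open Scope ereal_scope.

Let shift (f : X -> R) (c : R) x := (f x + (- c) * cst 1 x)%R.

Let oneL : cst 1%R \in Lfun pi 2%:E. Proof. exact: Lfun_cst. Qed.

(** The cross term -2 c <f, 1> vanishes for centred f, leaving the nonnegative c^2 <1, 1>. *)
Lemma ip_shift_ge f c : L2_0 pi f -> (ip pi f f <= ip pi (shift f c) (shift f c))%R.
Proof.
move=> [fL f0].
have f1 : ip pi f (cst 1%R) = 0%R.
  apply: EFin_inj; rewrite -integral_ip// -[RHS]f0.
  by apply: eq_integral => x _; rewrite mulr1.
rewrite ip_combr ?ip_combl ?Lfun2_comb// (ip_sym _ (cst _) f) f1.
by have := ip_ge0 pi (cst 1%R); nra.
Qed.

Lemma dirichlet_shift f c : dirichlet p pi (shift f c) = dirichlet p pi f.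
Proof.
apply: eq_integral => x _; apply: eq_integral => y _.
by rewrite /shift; congr EFin; ring.
Qed.

Lemma dirichlet_gap f : L2_0 pi f ->
  (lambda * ip pi f f <=
   (1 + 2 * b / alpha) * (ip pi f f - ip pi f (markov_opr p f)))%R.
Proof.
move=> f0; have fL := f0.1; have mf := Lfun2_measurable fL.
pose kap y := \int[pi]_x ((f x - f y) ^+ 2 * \1_K x)%:E.
have kap0 y : 0 <= kap y.
  by apply: integral_ge0 => x _; rewrite lee_fin mulr_ge0 ?sqr_ge0.
(* f - f(y) is used instead of f - nu(f), whose integrability would be needed. *)
have lya y : (2 * (lambda * ip pi f f))%:E <=
    dirichlet p pi f + 2%:E * (b%:E * kap y).
  have := lyapunov_dirichlet_le rev mV V_ge1 b_ge0 lambda_ge0 mK drift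
    (Lfun2_comb (- f y) fL oneL).
  rewrite -/(shift f (f y)) dirichlet_shift.
  under eq_integral do rewrite mulr1.
  apply: le_trans; rewrite lee_fin ler_wpM2l// ler_wpM2l//.
  exact: ip_shift_ge.
have mkap : measurable_fun setT kap.
  pose F z := ((f z.1 - f z.2) ^+ 2 * \1_K z.1)%:E.
  apply: (measurable_fun_fubini_tonelli_G (m1 := pi) F) => [|z].
    apply/measurable_EFinP; apply: measurable_funM.
      apply: measurable_funX.
      by apply: measurable_funB; exact: measurableT_comp.
    by apply: measurableT_comp => //; exact: measurable_fst.
  by rewrite lee_fin mulr_ge0 ?sqr_ge0.
have minD := minorization_dirichlet_le pi (ltW alpha_gt0) mK minor mf.
have D0 : 0 <= dirichlet p pi f.
  by apply: integral_ge0 => x _; apply: integral_ge0 => y _; rewrite lee_fin sqr_ge0.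
have S0 := ip_ge0 pi f.
(* [lya] averaged over nu(dy): only [kap] depends on y, and the other terms are constants under a
   probability. *)
have : (2 * (lambda * ip pi f f))%:E <=
    dirichlet p pi f + 2%:E * (b%:E * \int[nu]_y kap y).
  have DE := dirichletE rev fL; rewrite DE in D0 lya *.
  rewrite -(integral_cst_probability (2 * _) (probability_setT nu)).
  rewrite -[X in _ <= X + _](integral_cst_probability _ (probability_setT nu)).
  rewrite -!ge0_integralZl_EFin -?ge0_integralD//; last 4 first.
  - by move=> y _; rewrite !mule_ge0.
  - by do 2 apply: emeasurable_funM => //.
  - by move=> y _; rewrite mule_ge0.
  - by apply: emeasurable_funM => //.
  apply: ge0_le_integral => //.
  - by move=> y _; rewrite lee_fin !mulr_ge0.
  - by apply: emeasurable_funD => //; do 2 apply: emeasurable_funM => //.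
have kapI0 : 0 <= \int[nu]_y kap y by apply: integral_ge0.
move: kapI0 minD; rewrite -/(\int[nu]_y kap y) dirichletE//.
set E := (2 * ip pi f f - _)%R.
(* An infinite average would contradict minorization, since alpha > 0 and the Dirichlet form is
   finite. *)
case: (\int[nu]_y kap y) => [k||]//; last first.
  by rewrite gt0_muley ?lte_fin.
rewrite -!EFinM -EFinD !lee_fin => k0 akE lE.
have E0 : (ip pi f f - ip pi f (markov_opr p f) = E / 2)%R by rewrite /E; field.
rewrite E0.
have kE : (k <= E / alpha)%R by rewrite ler_pdivlMr// mulrC.
rewrite -(ler_pM2l (ltr0n R 2)) (le_trans lE)//.
(* The factor 2 on the left and the half in E / 2 cancel, so (1 + 2b/alpha) E splits into the two
   terms of the averaged bound. *)
rewrite [leRHS](_ : _ = (E + 2 * (b * (E / alpha)))%R); last first.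
  by field; rewrite gt_eqF.
by rewrite lerD2l !ler_wpM2l.
Qed.

End dirichlet_gap.

(** * Signs and sizes of the constants, and the resulting spectral gap *)

Theorem corollary1 (R : realType) (X : ptopologicalType)
    (p : R.-pker (borelType X) ~> (borelType X))
    (pi : probability (borelType X) R)
    (V : borelType X -> R) (b alpha lambda : R) (K : set (borelType X))
    (nu : probability (borelType X) R) :
  polish R X ->
  unique_invariant_proba p pi ->
  reversible p pi ->
  measurable_fun setT V ->
  (forall x, 1 <= V x) ->
  0 < alpha -> 0 < lambda ->
  measurable K ->
  (forall x, (markov_op p (EFin \o V) x
              <= ((1 - lambda) * V x + b * \1_K x)%:E)%E) ->
  (forall x (A : set (borelType X)), measurable A ->
     (alpha%:E * nu A * (\1_K x)%:E <= markov_op p (EFin \o \1_A) x)%E) ->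
  pos_semidef_L2 p pi ->
  spectral_gap p pi (lambda / (1 + 2 * b / alpha)).
Proof.
move=> _ _ rev mV V1 a0 l0 mK drift minor psd.
have x0 : borelType X := point.
(* The sign of [b] is not given. As b 1_K <= max(b, 0), the drift constraint applies to this
   maximum, and lambda > 0 then forces b >= lambda > 0. *)
have b0_lb : lambda <= Num.max b 0.
  apply: (drift_rate_le x0 mV V1 (ltW l0)) => x.
  apply: (le_trans (drift x)); rewrite lee_fin lerD2l indicE.
  by case: (_ \in _); rewrite ?mulr1 ?mulr0 le_max lexx ?orbT.
have [lb b0] : lambda <= b /\ 0 < b.
  by move: b0_lb; rewrite le_max => /orP[lb|]; [split => //; lra|lra].
(* With [K] empty, drift would hold with constant 0 and force lambda <= 0. *)
have [x Kx] : exists x, K x.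
  apply: contrapT => K0; have : lambda <= 0; last by rewrite leNgt l0.
  apply: (drift_rate_le x0 mV V1 (ltW l0)) => x.
  apply: (le_trans (drift x)); rewrite lee_fin lerD2l indicE memNset ?mulr0//.
  by move=> Kx; apply: K0; exists x.
have a1 := minorization_le1 minor Kx.
set c := 1 + 2 * b / alpha.
have c0 : 0 < c by rewrite addr_gt0// divr_gt0// mulr_gt0.
split; first exact: divr_gt0.
apply: opnorm_L2_0_le => //.
  (* The bound 1 - beta must be nonnegative: lambda <= b <= b/alpha because alpha <= 1, so lambda is
     below 1 + 2b/alpha. *)
  rewrite subr_ge0 ler_pdivrMr// mul1r /c.
  have : b <= b / alpha by rewrite ler_pdivlMr// ler_piMr// ltW.
  lra.
move=> f f0.
have := dirichlet_gap rev mV V1 (ltW b0) a0 (ltW l0) mK drift minor f0.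
rewrite -/c -ler_pdivrMl// mulrA (mulrC c^-1); lra.
Qed.
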